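(* Consider the renewal system and the iterative algorithm described in the context, run with any deterministic $\theta[0]\in[\theta_{min},\theta_{max}]$ and with stepsizes $\eta[k]=\frac{1}{(k+2)T_{min}}$ for all $k\in\{0,1,2,\ldots\}$. Then $$\mathbb{E}\big[(\theta[k]-\theta^* )^2\big]\le\frac{2b}{k\,T_{min}^2}\qquad\text{for all }k\in\{1,2,3,\ldots\}.$$
   Context: System: $\{S[k]\}_{k=0}^\infty$ is an i.i.d. sequence of random vectors with values in $\Omega_S\subseteq\mathbb{R}^m$. For each $s\in\Omega_S$, $\mathcal{D}(s)$ is a compact subset of $(0,\infty)\times(-\infty,\infty)$. On each frame $k\in\{0,1,2,\ldots\}$ a decision $(T[k],R[k])\in\mathcal{D}(S[k])$ is chosen; $T[k]$ and $R[k]$ are random variables (measurable). There are functions $L,M:\Omega_S\to[0,\infty)$ with $t\ge L(s)$ and $t^2+r^2\le M(s)$ for all $(t,r)\in\mathcal{D}(s)$, $s\in\Omega_S$, such that $L(S[0]),M(S[0])$ are random variables with $\mathbb{E}[L(S[0])]>0$ and $\mathbb{E}[M(S[0])]<\infty$. Consequently there are constants $T_{min}>0$, $T_{max}$, $R_{min}$, $R_{max}$, $C_1$, $C_2$ (fixed throughout) such that, regardless of how decisions are made, for all $k$: $T_{min}\le\mathbb{E}[T[k]]\le T_{max}$, $R_{min}\le\mathbb{E}[R[k]]\le R_{max}$, $\mathbb{E}[T[k]^2]\le C_1$, $\mathbb{E}[R[k]^2]\le C_2$. Optimal ratio: $\mathcal{A}\subseteq\mathbb{R}^2$ is the set of all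 one-shot expectations $(\mathbb{E}[T[0]],\mathbb{E}[R[0]])$ achievable on frame $0$ over all (measurable, possibly randomized) conditional distributions for choosing $(T[0],R[0])\in\mathcal{D}(S[0])$ given $S[0]$; $\overline{\mathcal{A}}$ is its closure. $\theta^*=\sup_{(t,r)\in\overline{\mathcal{A}}}\{r/t\}$. The finite constants $\theta_{min},\theta_{max}$ satisfy $\theta_{min}\le\theta^*\le\theta_{max}$. Algorithm: given deterministic $\theta[0]\in[\theta_{min},\theta_{max}]$ and deterministic positive stepsizes $\{\eta[k]\}$, on each frame $k$: observe $S[k]$ and $\theta[k]$; choose $(T[k],R[k])\in\mathcal{D}(S[k])$ to maximize $R[k]-\theta[k]T[k]$ (ties broken by an arbitrary rule making $(T[k],R[k])$ a measurable function of $(\theta[k],S[k])$); then update $\theta[k+1]=\big[\theta[k]+\eta[k](R[k]-\theta[k]T[k])\big]_{\theta_{min}}^{\theta_{max}}$, where $[x]_{\theta_{min}}^{\theta_{max}}$ is the projection of $x$ onto $[\theta_{min},\theta_{max}]$. The constant $b$ satisfies $\frac12\mathbb{E}[(R[k]-\theta[k]T[k])^2]\le b$ for all $k\in\{0,1,2,\ldots\}$ under this algorithm. *)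

(* Defs.v *)
From HB Require Import structures.
From mathcomp Require Import all_boot all_order all_algebra finmap.
From mathcomp Require Import all_classical all_reals all_analysis.

Set Implicit Arguments.
Unset Strict Implicit.
Unset Printing Implicit Defensive.
Import Order.TTheory GRing.Theory Num.Theory.
Import numFieldNormedType.Exports.
Local Open Scope classical_set_scope.
Local Open Scope ring_scope.

(* R^m and R^2 with their Borel sigma-algebras (generated by the coordinates). *)
Notation Rvec R m := (m.-tuple (measurableTypeR R)).
Notation Rpair R := (measurableTypeR R * measurableTypeR R)%type.

Section Iid.
Context d (W : measurableType d) (R : realType) (P : probability W R).
Context d' (V : measurableType d').

Definition identically_distributed (S : nat -> W -> V) : Prop :=
  forall (k : nat) (B : set V), measurable B -> P (S k @^-1` B) = P (S 0%N @^-1` B).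

Definition mutually_independent (S : nat -> W -> V) : Prop :=
  forall (J : {fset nat}) (B : nat -> set V),
    (forall j, measurable (B j)) ->
    P (\bigcap_(j in [set` J]) (S j @^-1` B j)) =
      (\prod_(j <- J) P (S j @^-1` B j))%E.

End Iid.

Section RenewalSystem.
Context d (W : measurableType d) (R : realType) (P : probability W R) (m : nat).
Context (S : nat -> W -> Rvec R m).
Context (OmegaS : set (Rvec R m)) (D : Rvec R m -> set (R * R)).

Record renewal_system (L M : Rvec R m -> R) : Prop := RenewalSystem {
  rs_meas : forall k, measurable_fun setT (S k) ;
  rs_val : forall k w, OmegaS (S k w) ;
  rs_ident : identically_distributed P S ;
  rs_indep : mutually_independent P S ;
  rs_compact : forall s, OmegaS s -> compact (D s) ;
  rs_pos : forall s x, OmegaS s -> D s x -> 0 < x.1 ;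
  rs_L_ge0 : forall s, OmegaS s -> 0 <= L s ;
  rs_M_ge0 : forall s, OmegaS s -> 0 <= M s ;
  rs_L_le : forall s x, OmegaS s -> D s x -> L s <= x.1 ;
  rs_M_ge : forall s x, OmegaS s -> D s x -> x.1 ^+ 2 + x.2 ^+ 2 <= M s ;
  rs_L_meas : measurable_fun setT (L \o S 0%N : W -> R) ;
  rs_M_meas : measurable_fun setT (M \o S 0%N : W -> R) ;
  rs_L_mean : ('E_P[L \o S 0%N] > 0)%E ;
  rs_M_mean : ('E_P[M \o S 0%N] < +oo)%E }.

(* A kernel on all of R^m, constrained only on OmegaS: since R^2 is standard
   Borel, kernels on OmegaS with its trace sigma-algebra extend to R^m. *)
Definition decision_kernel (kappa : R.-pker (Rvec R m) ~> (Rpair R)) : Prop :=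
  forall s, OmegaS s -> kappa s (D s) = 1%E.

(* E[f (T[k], R[k])] when (T[k], R[k]) has conditional law kappa (S[k]) given
   S[k]. *)
Definition frame_mean (k : nat) (kappa : R.-pker (Rvec R m) ~> (Rpair R))
    (f : R * R -> R) : \bar R :=
  (\int[P]_w \int[kappa (S k w)]_x (f x)%:E)%E.

Definition achievable : set (R * R) :=
  [set a | exists kappa : R.-pker (Rvec R m) ~> (Rpair R),
     [/\ decision_kernel kappa,
         frame_mean 0 kappa fst = a.1%:E &
         frame_mean 0 kappa snd = a.2%:E]].

Definition opt_ratio : R := sup [set a.2 / a.1 | a in closure achievable].

(* Averaging over the past, any way of making decisions yields some conditional
   law of (T[k], R[k]) given S[k], so bounds that hold regardless of how
   decisions are made are bounds over all decision kernels. *)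
Record moment_bounds (Tmin Tmax Rmin Rmax C1 C2 : R) : Prop := MomentBounds {
  mb_Tmin_gt0 : 0 < Tmin ;
  mb_T : forall k kappa, decision_kernel kappa ->
    (Tmin%:E <= frame_mean k kappa fst <= Tmax%:E)%E ;
  mb_R : forall k kappa, decision_kernel kappa ->
    (Rmin%:E <= frame_mean k kappa snd <= Rmax%:E)%E ;
  mb_T2 : forall k kappa, decision_kernel kappa ->
    (frame_mean k kappa (fun x => (x.1 ^+ 2)%R) <= C1%:E)%E ;
  mb_R2 : forall k kappa, decision_kernel kappa ->
    (frame_mean k kappa (fun x => (x.2 ^+ 2)%R) <= C2%:E)%E }.

Definition clip (a b x : R) : R := Num.max a (Num.min b x).

(* g is measurable on the whole space because [measurable_fun A g] is vacuous
   when A is not measurable, and OmegaS is arbitrary. Only the values of g on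
   [thmin, thmax] x OmegaS matter. *)
Definition greedy_rule (thmin thmax : R)
    (g : measurableTypeR R * Rvec R m -> Rpair R) : Prop :=
  measurable_fun setT g /\
  forall (th : R) s, thmin <= th <= thmax -> OmegaS s ->
    D s (g (th, s)) /\
    forall x, D s x -> x.2 - th * x.1 <= (g (th, s)).2 - th * (g (th, s)).1.

(* The tie-breaking rule g k may differ from frame to frame. *)
Record greedy_run (thmin thmax theta0 : R) (eta : nat -> R)
    (theta T Rw : nat -> W -> R) : Prop := GreedyRun {
  gr_init : forall w, theta 0%N w = theta0 ;
  gr_decide : exists g : nat -> measurableTypeR R * Rvec R m -> Rpair R,
    (forall k, greedy_rule thmin thmax (g k)) /\
    (forall k w, (T k w, Rw k w) = g k (theta k w, S k w)) ;
  gr_update : forall k w,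
    theta k.+1 w =
      clip thmin thmax (theta k w + eta k * (Rw k w - theta k w * T k w)) }.

End RenewalSystem.

(* Main.v *)
Require Import Defs.
From HB Require Import structures.
From mathcomp Require Import all_boot all_order all_algebra finmap.
From mathcomp Require Import all_classical all_reals all_analysis.
From mathcomp Require Import measurable_realfun ring lra.

Set Implicit Arguments.
Unset Strict Implicit.
Unset Printing Implicit Defensive.
Import Order.TTheory GRing.Theory Num.Theory.
Import numFieldNormedType.Exports.
Local Open Scope classical_set_scope.
Local Open Scope ring_scope.

(** Write [h(theta, s) = (theta - theta* ) (r - theta t)] for [(t, r)] the greedy
    decision at [(theta, s)].  For a fixed [theta] its mean over [s] is at most
    [- Tmin (theta - theta* )^2]: if [theta >= theta*], because the greedy means
    satisfy [r <= theta* t]; if [theta < theta*], because they maximise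
    [r - theta t] over achievable pairs, some of which have a ratio close to
    [theta*].  Since [theta[k]] only depends on [S[0], ..., S[k-1]], it is
    independent of [S[k]] and Fubini's theorem transfers this bound to the run.
    As the projection is nonexpansive, [z[k] = E (theta[k] - theta* )^2] satisfies
    [z[k+1] <= (1 - 2/(k+2)) z[k] + c/(k+2)^2] with [c = 2b/Tmin^2], and
    [z[k] <= c/k] follows by induction. *)

(** * Topology of the plane: Borel sets, and ratios over a closure *)

(** The plane is second countable: an open set is the union of the countably many rational squares
    [B q] that it contains, and each square is a measurable rectangle. *)
Lemma open_measurable_pair (R : realType) (U : set (R * R)) :
  open U -> measurable (U : set (Rpair R)).
Proof.
move=> oU.
pose B (q : rat * rat * rat) : set (Rpair R) :=
  (ball (ratr q.1.1 : R) (ratr q.2)) `*` (ball (ratr q.1.2 : R) (ratr q.2)).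
have -> : U = \bigcup_q (if `[< B q `<=` U >] then B q else set0).
  apply/seteqP; split => [[x y] Uxy|x [q _]]; last first.
    by case: ifPn => // /asboolP; apply.
  have /nbhs_ballP[e /= e0 eU] : nbhs (x, y) U by exact: open_nbhs_nbhs.
  have e20 : 0 < e / 2 by rewrite divr_gt0.
  (* With a rational radius below [e / 2], a square containing [(x, y)] stays within distance [e] of
     it. *)
  have [r /[!in_itv]/= /andP[r0 re]] := rat_in_itvoo e20.
  have near_rat (z : R) : exists q : rat, ball (ratr q : R) (ratr r) z.
    have zr : z < z + ratr r by rewrite ltrDl.
    have [q /[!in_itv]/= /andP[zq qz]] := rat_in_itvoo zr.
    exists q; rewrite /ball/= gtr0_norm ?subr_gt0// ltrBlDl addrC//.
    by rewrite addrC.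
  have [[q1 q1x] [q2 q2y]] := (near_rat x, near_rat y).
  exists (q1, q2, r) => //; case: ifPn => [_|/asboolP[]]; first by split.
  move=> [u v] [/= uB vB]; apply: eU; split => /=.
    apply: (le_ball (e1 := ratr r + ratr r)); last exact: (ball_triangle (ball_sym q1x)).
    by rewrite (splitr e) lerD// ltW.
  apply: (le_ball (e1 := ratr r + ratr r)); last exact: (ball_triangle (ball_sym q2y)).
  by rewrite (splitr e) lerD// ltW.
apply: countable_bigcupT_measurable => [|q]; first exact: countableP.
by case: ifPn => // _; apply: measurableX; apply: open_measurable; exact: ball_open.
Qed.

(** Makes each [D s] an event, so that integrals against a decision kernel can be restricted to
    it. *)
Lemma compact_measurable_pair (R : realType) (K : set (R * R)) :
  compact K -> measurable (K : set (Rpair R)).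
Proof.
have cl : compact K -> closed K by exact: compact_closed (@norm_hausdorff R (R * R)%type).
move=> /cl clK; rewrite -(setCK K); apply: measurableC.
exact: open_measurable_pair (closed_openC clK).
Qed.

(* Over the closure of the achievable pairs, [r - theta t] is still at most its
   greedy value; dividing by [t >= Tmin] bounds every ratio. *)
Lemma ratio_gap (R : realType) (A : set (R * R)) (Tmin Rmax th : R) (a0 : R * R) :
  0 < Tmin -> A a0 -> (forall a, A a -> Tmin <= a.1 /\ a.2 <= Rmax) ->
  (forall a, A a -> a.2 - th * a.1 <= a0.2 - th * a0.1) ->
  forall ths, ths = sup [set a.2 / a.1 | a in closure A] ->
  (th - ths) * (a0.2 - th * a0.1) <= - Tmin * (th - ths) ^+ 2.
Proof.
move=> T0 Aa0 AB Amax ths thsE; set c := a0.2 - th * a0.1.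
have cfst : continuous (fst : R * R -> R) by move=> x; exact: cvg_fst.
have csnd : continuous (snd : R * R -> R) by move=> x; exact: cvg_snd.
(* A sublevel set of a continuous function is closed, so the bound extends from [A] to its
   closure. *)
have clA (h : R * R -> R) r : continuous h -> (forall a, A a -> h a <= r) ->
    forall a, closure A a -> h a <= r.
  move=> ch hA a clAa.
  have : closed (h @^-1` [set x | x <= r]).
    by apply: closed_comp => //; exact: closed_le.
  by move/closure_id => E; suff : (h @^-1` [set x | x <= r]) a by [];
    rewrite E; apply: closureS clAa => ?; exact: hA.
have clT a : closure A a -> Tmin <= a.1.
  move=> /(clA (fun a => - a.1) (- Tmin)); rewrite lerN2; apply.
    by move=> x; apply: cvgN; exact: cfst.
  by move=> x /AB[]; rewrite lerN2.
have clR : forall a, closure A a -> a.2 <= Rmax.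
  by apply: clA => // x /AB[].
have clc : forall a, closure A a -> a.2 - th * a.1 <= c.
  apply: clA => // x; apply: cvgB; first exact: csnd.
  by apply: cvgM; [exact: cvg_cst|exact: cfst].
(* [sup] dominates its elements only for a set bounded above. The maximum with [0] keeps the
   division by [a.1 >= Tmin] valid when [Rmax] is negative. *)
have ub : has_ubound [set a.2 / a.1 | a in closure A].
  exists (Num.max Rmax 0 / Tmin) => _ [a Aa <-].
  have a0' := lt_le_trans T0 (clT a Aa).
  rewrite ler_pdivrMr// (@le_trans _ _ (Num.max Rmax 0))//.
    by rewrite le_max clR.
  by rewrite -mulrA ler_peMr ?le_max ?lexx ?orbT// mulrC ler_pdivlMr// mul1r clT.
(* If [ths <= th], the ratio of [a0] is at most [ths], so [c <= - (th - ths) * a0.1 <= - Tmin * (th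
   - ths)]. *)
have [ths_th|th_ths] := leP ths th.
  have a00 := lt_le_trans T0 (AB _ Aa0).1.
  have ra : a0.2 / a0.1 <= ths.
    rewrite thsE; apply: ub_le_sup => //.
    by exists a0 => //; exact: subset_closure.
  rewrite ler_pdivrMr// in ra.
  have := (AB _ Aa0).1 => Ta.
  have cle : c <= - Tmin * (th - ths).
    have : 0 <= (th - ths) * (a0.1 - Tmin) by rewrite mulr_ge0 ?subr_ge0.
    rewrite /c; lra.
  have : 0 <= (th - ths) * (- Tmin * (th - ths) - c) by rewrite mulr_ge0 ?subr_ge0.
  by lra.
suff : (ths - th) * Tmin <= c.
  move=> cge; have : 0 <= (ths - th) * (c - (ths - th) * Tmin).
    by rewrite mulr_ge0 ?subr_ge0// ltW.
  by lra.
(* Each ratio exceeds [th] by at most [c / a.1], hence by at most [Num.max c 0 / Tmin]. In the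
   resulting bound on [ths], the alternative [0] is excluded by [th < ths]. *)
suff : ths <= th + Num.max c 0 / Tmin.
  rewrite -lerBlDl ler_pdivlMr// le_max => /orP[//|].
  by rewrite leNgt mulr_gt0// subr_gt0.
rewrite thsE; apply: ge_sup => [|_ [a Aa <-]].
  by exists (a0.2 / a0.1), a0 => //; exact: subset_closure.
have a10 := lt_le_trans T0 (clT a Aa).
rewrite ler_pdivrMr// mulrDl -lerBlDl (le_trans (clc _ Aa))//.
rewrite (@le_trans _ _ (Num.max c 0))// ?le_max ?lexx//.
by rewrite -mulrA ler_peMr ?le_max ?lexx ?orbT// mulrC ler_pdivlMr// mul1r clT.
Qed.

(** * Integrals against a probability measure carried by a set *)

Section ConcentratedMeasure.
Context d (Y : measurableType d) (R : realType) (mu : {measure set Y -> \bar R}).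
Context (A : set Y) (mA : measurable A) (muT : mu setT = 1%E) (muA : mu A = 1%E).

Let muCA : mu (~` A) = 0%E.
Proof.
rewrite -setTD measureD//=; last by rewrite muT ltry.
by rewrite setTI muT muA subee.
Qed.

Let muC_ae (Q : Y -> Prop) : (forall y, A y -> Q y) -> {ae mu, forall y, Q y}.
Proof.
by move=> QA; exists (~` A); split=> [||y /= nQ /QA]; [exact: measurableC|..].
Qed.

(** The complement of [A] is null, so a bound on [A] alone is an almost-everywhere bound. The
    intended measures are the conditional laws [kappa s], carried by [D s]. *)
Lemma concentrated_integrable (f : Y -> R) (c : R) :
  measurable_fun setT f -> (forall y, A y -> `|f y| <= c) -> 0 <= c ->
  mu.-integrable setT (EFin \o f) /\ (`|\int[mu]_y (f y)%:E| <= c%:E)%E.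
Proof.
move=> mf fc c0.
have mEf : measurable_fun setT (EFin \o f) by exact/measurable_EFinP.
have bd : (\int[mu]_y `|(f y)%:E| <= c%:E)%E.
  have /= := @integral_le_bound _ _ _ mu setT (EFin \o f) c%:E.
  rewrite muT mule1; apply => //.
  by apply: muC_ae => y Ay _; rewrite /= lee_fin fc.
split; last by rewrite (le_trans _ bd)//; exact: le_abse_integral.
by apply/integrableP; split => //; rewrite (le_lt_trans bd)// ltry.
Qed.

(** Discarding the null complement of [A] leaves an integral over a set of mass one. *)
Lemma concentrated_le_integral (f : Y -> R) (c : R) :
  mu.-integrable setT (EFin \o f) -> (forall y, A y -> f y <= c) ->
  (\int[mu]_y (f y)%:E <= c%:E)%E.
Proof.
move=> intf fc.
rewrite (negligible_integral _ _ intf muCA)//; last exact: measurableC.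
rewrite setDE setTI setCK (@le_trans _ _ (\int[mu]_(y in A) c%:E)%E)//.
  apply: le_integral => //.
  - exact: (integrableS measurableT).
  - apply/integrableP; split => //=.
    by rewrite integral_cst// muA mule1 ltry.
  - by move=> y; rewrite inE => Ay; rewrite lee_fin fc.
by rewrite integral_cst// muA mule1.
Qed.

End ConcentratedMeasure.

(** * One-shot means of decision kernels and optimality of the greedy rule *)

Section DecisionMeans.
Context d (W : measurableType d) (R : realType) (P : probability W R) (m : nat).
Context (S : nat -> W -> Rvec R m) (OmegaS : set (Rvec R m)).
Context (D : Rvec R m -> set (R * R)) (L M : Rvec R m -> R).
Hypothesis sys : renewal_system P S OmegaS D L M.

Let measurable_D s : OmegaS s -> measurable (D s : set (Rpair R)).
Proof. by move=> /(rs_compact sys); exact: compact_measurable_pair. Qed.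

Let bound_integrable : P.-integrable setT (fun w => (1 + M (S 0%N w))%:E).
Proof.
have mM : measurable_fun setT (M \o S 0%N) := rs_M_meas sys.
apply: (@integrableD _ _ _ _ _ _ (cst 1%E) (fun w => (M (S 0%N w))%:E)) => //.
  exact: finite_measure_integrable_cst.
apply/integrableP; split; first exact/measurable_EFinP.
have := rs_M_mean sys; rewrite unlock; congr (_ < _)%E.
apply: eq_integral => w _ /=; rewrite ger0_norm//.
exact/(rs_M_ge0 sys)/(rs_val sys).
Qed.

(** Follows from [u <= 1 + u^2]; the function [1 + M] then dominates all first-order frame means. *)
Let decision_bounded s x : OmegaS s -> D s x -> `|x.1| <= 1 + M s /\ `|x.2| <= 1 + M s.
Proof.
move=> Os /(rs_M_ge sys Os).
rewrite -(real_normK (num_real x.1)) -(real_normK (num_real x.2)).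
move: `|x.1| `|x.2| (normr_ge0 x.1) (normr_ge0 x.2) => u v u0 v0 H.
have := sqr_ge0 (u - 1); have := sqr_ge0 (v - 1).
have := sqr_ge0 u; have := sqr_ge0 v; split; nra.
Qed.

(** [1 + M] dominates [f] on each [D s], hence also the inner means; since [M (S 0)] has finite
    mean, the outer integral converges too. *)
Lemma kernel_mean_integrable (kappa : R.-pker (Rvec R m) ~> (Rpair R))
    (f : Rpair R -> R) :
  decision_kernel OmegaS D kappa -> measurable_fun setT f ->
  (forall s x, OmegaS s -> D s x -> `|f x| <= 1 + M s) ->
  (forall w, (kappa (S 0%N w)).-integrable setT (EFin \o f)) /\
  P.-integrable setT (fun w => \int[kappa (S 0%N w)]_x (f x)%:E)%E.
Proof.
move=> kD mf fM.
have conc w : (kappa (S 0%N w)).-integrable setT (EFin \o f) /\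
    (`|\int[kappa (S 0%N w)]_x (f x)%:E| <= (1 + M (S 0%N w))%:E)%E.
  have Os := rs_val sys 0%N w.
  apply: (@concentrated_integrable _ _ _ (kappa (S 0%N w)) (D (S 0%N w))) => //.
  - exact: measurable_D.
  - exact: prob_kernel.
  - exact: kD.
  - by move=> x; exact: fM.
  - by rewrite addr_ge0// (rs_M_ge0 sys).
split=> [w|]; first by case: (conc w).
apply: le_integrable bound_integrable => //= [|w _]; last first.
  have [_ h] := conc w; rewrite (le_trans h)// lee_fin ger0_norm//.
  by rewrite addr_ge0// (rs_M_ge0 sys)//; exact: rs_val sys _ _.
have mEf : measurable_fun setT (EFin \o f) by exact/measurable_EFinP.
apply: (measurableT_comp (f := fun s => (\int[kappa s]_x (f x)%:E)%E));
  last exact: rs_meas sys 0%N.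
(* Positive and negative parts reduce measurability in [s] to nonnegative integrands. *)
rewrite (_ : (fun s => _) = fun s =>
    (\int[kappa s]_x ((EFin \o f)^\+ x) -
    \int[kappa s]_x ((EFin \o f)^\- x))%E); last first.
  by apply/funext => s; rewrite integralE.
apply: emeasurable_funB; apply: measurable_fun_integral_kernel => //.
- by move=> U mU; exact: measurable_kernel.
- exact: measurable_funepos.
- by move=> U mU; exact: measurable_kernel.
- exact: measurable_funeneg.
Qed.

Lemma kernel_mean_fst (kappa : R.-pker (Rvec R m) ~> (Rpair R)) :
  decision_kernel OmegaS D kappa ->
  (forall w, (kappa (S 0%N w)).-integrable setT (fun x => (x.1)%:E)) /\
  P.-integrable setT (fun w => \int[kappa (S 0%N w)]_x (x.1)%:E)%E.
Proof.
move=> kD; apply: (kernel_mean_integrable kD) => [|s x Os Dx].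
  exact: measurable_fst.
exact: (decision_bounded Os Dx).1.
Qed.

Lemma kernel_mean_snd (kappa : R.-pker (Rvec R m) ~> (Rpair R)) :
  decision_kernel OmegaS D kappa ->
  (forall w, (kappa (S 0%N w)).-integrable setT (fun x => (x.2)%:E)) /\
  P.-integrable setT (fun w => \int[kappa (S 0%N w)]_x (x.2)%:E)%E.
Proof.
move=> kD; apply: (kernel_mean_integrable kD) => [|s x Os Dx].
  exact: measurable_snd.
exact: (decision_bounded Os Dx).2.
Qed.

(** Linearity at both levels of integration; it translates pointwise maximisation of [r - th * t]
    into maximisation over achievable pairs. *)
Lemma kernel_mean_penalty (kappa : R.-pker (Rvec R m) ~> (Rpair R)) (th : R) (a : R * R) :
  decision_kernel OmegaS D kappa ->
  frame_mean P S 0 kappa fst = a.1%:E -> frame_mean P S 0 kappa snd = a.2%:E ->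
  P.-integrable setT (fun w => \int[kappa (S 0%N w)]_x (x.2 - th * x.1)%:E)%E /\
  frame_mean P S 0 kappa (fun x => x.2 - th * x.1) = (a.2 - th * a.1)%:E.
Proof.
move=> kD E1 E2.
have [i1 I1] := kernel_mean_fst kD.
have [i2 I2] := kernel_mean_snd kD.
have inner w : (\int[kappa (S 0%N w)]_x (x.2 - th * x.1)%:E =
    \int[kappa (S 0%N w)]_x (x.2)%:E - th%:E * \int[kappa (S 0%N w)]_x (x.1)%:E)%E.
  rewrite -(integralZl measurableT (i1 w)).
  by rewrite -(integralB measurableT (i2 w) (integrableZl measurableT th (i1 w))).
have IZ := integrableZl measurableT th I1.
split.
  by apply: eq_integrable (integrableB measurableT I2 IZ) => // w _; rewrite inner.
rewrite /frame_mean; under eq_integral do rewrite inner.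
by rewrite (integralB measurableT I2 IZ) (integralZl measurableT I1) EFinB EFinM -E1 -E2.
Qed.

Context (thmin thmax : R) (g : measurableTypeR R * Rvec R m -> Rpair R).
Hypothesis greedy : greedy_rule OmegaS D thmin thmax g.

Lemma measurable_section th : measurable_fun setT (fun s => g (th, s)).
Proof.
by have [mg _] := greedy; apply: measurableT_comp => //; exact: pair1_measurable.
Qed.

(** A deterministic decision is a randomised one with a Dirac conditional law; this makes the greedy
    means an achievable pair. *)
Lemma greedy_kernel th : thmin <= th <= thmax ->
  decision_kernel OmegaS D (kdirac (measurable_section th)).
Proof.
move=> thb s Os; have [Dg _] := greedy.2 th s thb Os.
by rewrite /= /kdirac /= diracE mem_set.
Qed.

(** For each [s] the greedy choice dominates every point of [D s], hence every average over a law
    carried by [D s]; integrating over [S 0] preserves the inequality. *)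
Lemma greedy_maximal th : thmin <= th <= thmax ->
  exists2 a0, achievable P S OmegaS D a0 &
    (forall a, achievable P S OmegaS D a -> a.2 - th * a.1 <= a0.2 - th * a0.1) /\
    P.-integrable setT
      (fun w => ((g (th, S 0%N w)).2 - th * (g (th, S 0%N w)).1)%:E) /\
    (\int[P]_w ((g (th, S 0%N w)).2 - th * (g (th, S 0%N w)).1)%:E =
      (a0.2 - th * a0.1)%:E)%E.
Proof.
move=> thb; have kD := greedy_kernel thb; set kg := kdirac _ in kD.
have [_ I1] := kernel_mean_fst kD.
have [_ I2] := kernel_mean_snd kD.
pose a0 := (fine (frame_mean P S 0 kg fst), fine (frame_mean P S 0 kg snd)).
have E1 : frame_mean P S 0 kg fst = a0.1%:E.
  by rewrite fineK//; exact: integrable_fin_num I1.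
have E2 : frame_mean P S 0 kg snd = a0.2%:E.
  by rewrite fineK//; exact: integrable_fin_num I2.
have [Ig Eg] := kernel_mean_penalty th kD E1 E2.
have dir w : (\int[kg (S 0%N w)]_x (x.2 - th * x.1)%:E =
    ((g (th, S 0%N w)).2 - th * (g (th, S 0%N w)).1)%:E)%E.
  rewrite integral_dirac//; first by rewrite diracT mul1e.
  apply/measurable_EFinP/measurable_funB => //.
  exact: measurable_funM.
exists a0; first by exists kg.
split=> [a [k [kD' F1 F2]]|]; last first.
  split; first by apply: eq_integrable Ig => // w _; rewrite dir.
  by rewrite -Eg; apply: eq_integral => w _; rewrite dir.
have [Ik Ek] := kernel_mean_penalty th kD' F1 F2.
rewrite -lee_fin -Ek -Eg; apply: le_integral => // w _; rewrite dir.
have Os := rs_val sys 0%N w.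
apply: (@concentrated_le_integral _ _ _ (k (S 0%N w)) (D (S 0%N w))).
- exact: measurable_D.
- exact: prob_kernel.
- exact: kD'.
- have [i1 _] := kernel_mean_fst kD'; have [i2 _] := kernel_mean_snd kD'.
  apply: eq_integrable (integrableB measurableT (i2 w)
    (integrableZl measurableT th (i1 w))) => //.
- by move=> x Dx; exact: (greedy.2 th _ thb Os).2.
Qed.
End DecisionMeans.

(** * Change of variables, and independence of a recursive state from the current sample *)

(** Both integrals are differences of integrals of positive and negative parts, so neither a sign
    nor integrability of [f] is required. *)
Lemma integral_pushforward_measurable d d' (X : measurableType d) (Y : measurableType d')
    (R : realType) {mu : {measure set X -> \bar R}} (phi : X -> Y)
    (mphi : measurable_fun setT phi) (f : Y -> \bar R) :
  measurable_fun setT f ->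
  (\int[pushforward mu phi]_y f y = \int[mu]_x f (phi x))%E.
Proof.
move=> mf; rewrite [LHS]integralE [RHS]integralE.
rewrite (ge0_integral_pushforward mphi)//; last exact: measurable_funepos.
rewrite (ge0_integral_pushforward mphi)//; last exact: measurable_funeneg.
by rewrite -!funepos_comp -!funeneg_comp preimage_setT.
Qed.

Section RecursiveState.
Context d (W : measurableType d) (R : realType) (P : probability W R).
Context dV (V : measurableType dV) dT (T : measurableType dT).
Context (S : nat -> W -> V) (X : nat -> W -> T) (F : nat -> T * V -> T) (x0 : T).
Hypothesis mS : forall k, measurable_fun setT (S k).
Hypothesis indepS : mutually_independent P S.
Hypothesis mF : forall k, measurable_fun setT (F k).
Hypothesis X0 : forall w, X 0%N w = x0.
Hypothesis XS : forall k w, X k.+1 w = F k (X k w, S k w).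

Lemma measurable_state k : measurable_fun setT (X k).
Proof.
elim: k => [|k IH].
  by rewrite (_ : X 0%N = cst x0)//; apply/funext => w; rewrite X0.
rewrite (_ : X k.+1 = F k \o (fun w => (X k w, S k w))).
  by apply: measurableT_comp => //; exact: measurable_fun_pair.
by apply/funext => w; rewrite XS.
Qed.

Let measurable_future (J : {fset nat}) (B : nat -> set V) :
  (forall j, measurable (B j)) ->
  measurable (\bigcap_(j in [set` J]) (S j @^-1` B j)).
Proof.
move=> mB; apply: fin_bigcap_measurable => // j _.
by rewrite -[X in measurable X]setTI; exact: mS.
Qed.

(** As [k] lies outside [J], adjoining it with the set [C] adds one constraint to the intersection
    and one factor to the product. *)
Let future_cons k (J : {fset nat}) (B : nat -> set V) C :
  (forall j, measurable (B j)) -> (forall j, j \in J -> (k < j)%N) -> measurable C ->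
  let B' j := if j == k then C else B j in
  \bigcap_(j in [set` (k |` J)%fset]) (S j @^-1` B' j) =
    S k @^-1` C `&` \bigcap_(j in [set` J]) (S j @^-1` B j) /\
  P (S k @^-1` C `&` \bigcap_(j in [set` J]) (S j @^-1` B j)) =
    (P (S k @^-1` C) * P (\bigcap_(j in [set` J]) (S j @^-1` B j)))%E.
Proof.
move=> mB Jk mC B'.
have Jne j : j \in J -> (j == k) = false by move=> /Jk; case: ltngtP.
have kJ : k \notin J by apply/negP => /Jk; rewrite ltnn.
have E : \bigcap_(j in [set` (k |` J)%fset]) (S j @^-1` B' j) =
    S k @^-1` C `&` \bigcap_(j in [set` J]) (S j @^-1` B j).
  apply/seteqP; split => w.
    move=> h; split => [|j /= jJ].
      by have := h k; rewrite /= /B' eqxx; apply; rewrite !inE eqxx.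
    by have := h j; rewrite /= /B' Jne//; apply; rewrite !inE jJ orbT.
  move=> [hk hJ] j /=; rewrite /B' !inE; have [->//|jk /=] := eqVneq j k.
  exact: hJ.
split; first exact: E.
rewrite -E indepS; last by move=> j; rewrite /B'; case: ifP.
rewrite big_fsetU1//= {1}/B' eqxx; congr (_ * _)%E.
rewrite indepS// big_seq [RHS]big_seq; apply: eq_bigr => j jJ.
by rewrite /B' Jne.
Qed.

(* Both sides of the product rule are finite measures in the set of values of
   [(X k, S k)] and agree on rectangles, hence everywhere. *)
Lemma state_indep_future k (J : {fset nat}) (B : nat -> set V) (A : set T) :
  (forall j, measurable (B j)) -> (forall j, j \in J -> (k <= j)%N) -> measurable A ->
  P (X k @^-1` A `&` \bigcap_(j in [set` J]) (S j @^-1` B j)) =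
  (P (X k @^-1` A) * P (\bigcap_(j in [set` J]) (S j @^-1` B j)))%E.
Proof.
(* The family [J] is generalised: [X k.+1] absorbs [S k], so the hypothesis for [X k] must apply to
   [J] with [k] adjoined. *)
elim: k J B A => [|k IH] J B A mB Jk mA.
  have [Ax0|nAx0] := pselect (A x0).
    rewrite (_ : X 0%N @^-1` A = setT) ?setTI ?probability_setT ?mul1e//.
    by apply/seteqP; split => // w _ /=; rewrite X0.
  rewrite (_ : X 0%N @^-1` A = set0) ?set0I ?measure0 ?mul0e//.
  by apply/seteqP; split => // w /=; rewrite X0.
set E := \bigcap_(j in _) _.
have mE : measurable E by exact: measurable_future.
pose phi w := (X k w, S k w).
have mphi : measurable_fun setT phi.
  by apply: measurable_fun_pair => //; exact: measurable_state.
(* [P E] as a nonnegative real: [n2] is the law of [(X k, S k)] scaled by it, and [n1] is the image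
   of [P] restricted to [E]. *)
pose r : {nonneg R} := NngNum (fine_ge0 (measure_ge0 P E)).
have rE : (r%:num)%:E = P E by rewrite /= fineK// fin_num_measure.
pose n1 : {measure set (T * V) -> \bar R} := pushforward (mrestr P mE) phi.
pose n2 : {measure set (T * V) -> \bar R} := mscale r (pushforward P phi).
(* The measurable rectangles, stable under intersection and generating the product sigma-algebra. *)
pose C : set (set (T * V)) :=
  [set C | exists2 A, measurable A & exists2 B, measurable B & A `*` B = C].
have n12 G : measurable G -> n1 mphi G = n2 mphi G.
  move=> mG; apply: (measure_unique C (fun=> setT)) => //.
  - exact: measurable_prod_measurableType.
  - move=> _ _ [A1 mA1 [B1 mB1 <-]] [A2 mA2 [B2 mB2 <-]].
    rewrite -setXI; exists (A1 `&` A2); first exact: measurableI.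
    by exists (B1 `&` B2) => //; exact: measurableI.
  - by move=> _; exists setT => //; exists setT => //; rewrite setXTT.
  - by apply/seteqP; split => // x _; exists 0%N.
  - move=> _ [A1 mA1 [B1 mB1 <-]].
    rewrite /n1 /n2 /= /mscale /= /pushforward /mrestr.
    have [EE EP] := future_cons mB Jk mB1.
    rewrite (_ : phi @^-1` (A1 `*` B1) = X k @^-1` A1 `&` S k @^-1` B1)//.
    (* The induction hypothesis serves twice: here for [J] with [k] adjoined, and below for [k]
       alone, to recombine the joint law of [(X k, S k)]. *)
    rewrite -setIA -EE IH//; first last.
    + by move=> j; rewrite !inE => /predU1P[->//|/Jk/ltnW].
    + by move=> j; case: ifP.
    rewrite EE EP.
    have := IH [fset k]%fset (fun=> B1) A1.
    rewrite bigcap_fset big_seq_fset1 rE => -> //;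
      last by move=> j; rewrite inE => /eqP->.
    by rewrite muleA muleC.
  - by move=> _; rewrite /n1 /= /pushforward /mrestr preimage_setT setTI ltey_eq
      fin_num_measure.
(* On this set, the equality of [n1] and [n2] is the claim for [X k.+1]. *)
have mFA : measurable (F k @^-1` A).
  by rewrite -[X in measurable X]setTI; exact: mF.
have := n12 _ mFA; rewrite /n1 /n2 /= /mscale /= /pushforward /mrestr rE.
rewrite (_ : phi @^-1` (F k @^-1` A) = X k.+1 @^-1` A); first by rewrite muleC.
by apply/seteqP; split => w /=; rewrite XS.
Qed.

Lemma state_indep_current k (A : set T) (B : set V) :
  measurable A -> measurable B ->
  P (X k @^-1` A `&` S k @^-1` B) = (P (X k @^-1` A) * P (S k @^-1` B))%E.
Proof.
move=> mA mB.
have := @state_indep_future k [fset k]%fset (fun=> B) A.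
rewrite bigcap_fset big_seq_fset1; apply => // j.
by rewrite inE => /eqP->.
Qed.

Hypothesis identS : identically_distributed P S.

(** By independence the joint law of [(X k, S k)] is the product of its marginals, so the state can
    be frozen while the sample is averaged. *)
Lemma state_Fubini k (h : T * V -> R) :
  measurable_fun setT h ->
  P.-integrable setT (fun w => (h (X k w, S k w))%:E) ->
  P.-integrable setT (fun w => \int[P]_w' (h (X k w, S 0%N w'))%:E)%E /\
  (\int[P]_w (h (X k w, S k w))%:E = \int[P]_w \int[P]_w' (h (X k w, S 0%N w'))%:E)%E.
Proof.
move=> mh ih; have mEh : measurable_fun setT (EFin \o h) by exact/measurable_EFinP.
pose Xk : {mfun W >-> T} :=
  HB.pack (X k) (isMeasurableFun.Build _ _ _ _ _ (measurable_state k)).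
pose Sk : {mfun W >-> V} := HB.pack (S k) (isMeasurableFun.Build _ _ _ _ _ (mS k)).
pose phi w := (X k w, S k w).
have mphi : measurable_fun setT phi.
  by apply: measurable_fun_pair => //; exact: measurable_state.
pose n1 : {measure set (T * V) -> \bar R} := pushforward P phi.
pose mu := distribution P Xk; pose nu := distribution P Sk.
have prodE : forall C, measurable C -> (mu \x nu)%E C = n1 mphi C.
  by apply: product_measure_unique => A B mA mB; exact: state_indep_current.
have inn1 : (n1 mphi).-integrable setT (EFin \o h) by exact: integrable_pushforward.
have imn : (mu \x nu)%E.-integrable setT (EFin \o h).
  move/integrableP : inn1 => [_ ltn1]; apply/integrableP; split => //.
  by rewrite (eq_measure_integral (n1 mphi))// => C mC _; exact: prodE.
(* Identical distribution enters here, replacing [S k] by [S 0] in the inner mean. *)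
have FE w : fubini_F nu (EFin \o h) (X k w) = (\int[P]_w' (h (X k w, S 0%N w'))%:E)%E.
  have mhx : measurable_fun setT (fun s => (h (X k w, s))%:E).
    exact: (measurableT_comp mEh (pair1_measurable (X k w))).
  rewrite /fubini_F -(integral_pushforward_measurable (mS 0%N) mhx).
  apply: eq_measure_integral => B mB _; exact: identS.
have iF := integrable_fubini_F imn.
split.
  under eq_fun do rewrite -FE.
  move/integrableP : iF => [mFF ltF]; apply/integrableP; split.
    exact: (measurableT_comp mFF (measurable_state k)).
  rewrite -(integral_pushforward_measurable (measurable_state k)
    (f := fun x => `|fubini_F nu (EFin \o h) x|%E))//.
  exact: measurableT_comp.
under [RHS]eq_integral do rewrite -FE.
rewrite -(integral_pushforward_measurable (measurable_state k) (measurable_int _ iF)).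
rewrite [RHS](integral12_prod_meas1 imn).
rewrite (eq_measure_integral (n1 mphi)); last by move=> C mC _; exact: prodE.
exact: esym (integral_pushforward_measurable mphi mEh).
Qed.

End RecursiveState.

(** * Projection onto an interval, and the scalar recursion *)

Lemma clip_itv (R : realType) (a b x : R) : a <= b -> a <= clip a b x <= b.
Proof. by move=> ab; rewrite /clip le_max lexx /= ge_max ab ge_min lexx. Qed.

(** The projection moves [x] only when it lies outside the interval, and then towards [y]. *)
Lemma sqr_clip_le (R : realType) (a b x y : R) : a <= y <= b ->
  (clip a b x - y) ^+ 2 <= (x - y) ^+ 2.
Proof.
move=> /andP[ay yb]; rewrite -ler_sqrt ?sqr_ge0// !sqrtr_sqr /clip.
have [xb|bx] := leP x b.
  by have [ax|xa] := leP a x => //; rewrite !ler0_norm; lra.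
by have [ab|ba] := leP a b; rewrite !ger0_norm; lra.
Qed.

(** At [k = 0] the coefficient of [z 0] vanishes, so the initial value is forgotten and
    [z 1 <= c / 4]. The induction step closes because [(n + 1) (n + 3) <= (n + 2)^2]. *)
Lemma recursion_rate (R : realType) (z : nat -> R) (c : R) :
  0 <= c ->
  (forall k, z k.+1 <= (1 - 2 / (k + 2)%N%:R) * z k + c / (k + 2)%N%:R ^+ 2) ->
  forall k, (1 <= k)%N -> z k <= c / k%:R.
Proof.
move=> c0 zS [//|k] _; elim: k => [|k IH].
  rewrite (le_trans (zS 0%N))// add0n divff// subrr mul0r add0r.
  by rewrite divr1 ler_pdivrMr// ler_peMr//; lra.
rewrite (le_trans (zS k.+1))//.
have n0 : 0 < k.+1%:R :> R by rewrite ltr0n.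
have -> : (k.+1 + 2)%N%:R = k.+1%:R + 2 :> R by rewrite natrD.
have -> : k.+2%:R = k.+1%:R + 1 :> R by rewrite -natr1.
move: (k.+1%:R) n0 IH => n n0 IH.
have p0 : 0 <= 1 - 2 / (n + 2) by rewrite subr_ge0 ler_pdivrMr; lra.
rewrite (@le_trans _ _ ((1 - 2 / (n + 2)) * (c / n) + c / (n + 2) ^+ 2))//.
  by rewrite lerD2r ler_wpM2l.
have -> : (1 - 2 / (n + 2)) * (c / n) + c / (n + 2) ^+ 2 = c * ((n + 3) / (n + 2) ^+ 2).
  by field; rewrite !gt_eqF//; lra.
rewrite ler_wpM2l// ler_pdivrMr ?exprn_gt0//; last by lra.
rewrite mulrC ler_pdivlMr; last by lra.
by nra.
Qed.

(** * Mean-square error of the iterates *)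

Theorem lemma6 (d : measure_display) (W : measurableType d) (R : realType)
  (P : probability W R) (m : nat)
  (S : nat -> W -> Rvec R m) (OmegaS : set (Rvec R m))
  (D : Rvec R m -> set (R * R)) (L M : Rvec R m -> R)
  (Tmin Tmax Rmin Rmax C1 C2 thmin thmax theta0 b : R)
  (theta T Rw : nat -> W -> R)
  (Hsys : renewal_system P S OmegaS D L M)
  (Hmom : moment_bounds P S OmegaS D Tmin Tmax Rmin Rmax C1 C2)
  (Hth : thmin <= opt_ratio P S OmegaS D <= thmax)
  (Hth0 : thmin <= theta0 <= thmax)
  (Hrun : greedy_run S OmegaS D thmin thmax theta0
            (fun k => 1 / ((k + 2)%N%:R * Tmin)) theta T Rw)
  (Hb : forall k : nat,
     ((1 / 2)%:E * 'E_P[fun w => ((Rw k w - theta k w * T k w) ^+ 2)%R]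
        <= b%:E)%E) :
  forall k : nat, (1 <= k)%N ->
    ('E_P[fun w => ((theta k w - opt_ratio P S OmegaS D) ^+ 2)%R]
       <= (2 * b / (k%:R * Tmin ^+ 2))%:E)%E.
Proof.
have [g [greedy TRg]] := gr_decide Hrun.
set ths := opt_ratio P S OmegaS D in Hth *.
have T0 := mb_Tmin_gt0 Hmom.
have thb : thmin <= thmax by case/andP: Hth; exact: le_trans.
pose eta k : R := 1 / ((k + 2)%N%:R * Tmin).
have eta0 k : 0 <= eta k by rewrite divr_ge0// mulr_ge0// ltW.
(* Penalty and update are written as functions of [(theta k, S k)], so that the run is a recursive
   state with transition [F k]. *)
pose pen k (x : measurableTypeR R * Rvec R m) : R := (g k x).2 - x.1 * (g k x).1.
have penE k w : Rw k w - theta k w * T k w = pen k (theta k w, S k w).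
  by rewrite /pen /= -TRg.
pose F k (x : measurableTypeR R * Rvec R m) : measurableTypeR R :=
  clip thmin thmax (x.1 + eta k * pen k x).
have mpen k : measurable_fun setT (pen k).
  have mg := (greedy k).1.
  apply: measurable_funB; first exact: measurableT_comp mg.
  by apply: measurable_funM => //; exact: measurableT_comp mg.
have mF k : measurable_fun setT (F k).
  apply: measurable_maxr => //; apply: measurable_minr => //.
  by apply: measurable_funD => //; exact: measurable_funM.
have mS := rs_meas Hsys.
have thetaS k w : theta k.+1 w = F k (theta k w, S k w).
  by rewrite (gr_update Hrun) penE.
have mth k : measurable_fun setT (theta k).
  exact: (measurable_state mS mF (gr_init Hrun) thetaS).
have thetab k w : thmin <= theta k w <= thmax.
  by case: k => [|k]; [rewrite (gr_init Hrun)|rewrite thetaS; exact: clip_itv].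
pose z k w := (theta k w - ths) ^+ 2.
pose q k w := pen k (theta k w, S k w) ^+ 2.
pose h k (x : measurableTypeR R * Rvec R m) : R := (x.1 - ths) * pen k x.
have mpair k : measurable_fun setT (fun w => (theta k w, S k w)).
  exact: measurable_fun_pair.
have mpenS k : measurable_fun setT (fun w => pen k (theta k w, S k w)).
  exact: measurableT_comp (mpen k) (mpair k).
have mz k : measurable_fun setT (z k) by apply: measurable_funX; exact: measurable_funB.
have mq k : measurable_fun setT (q k) by apply: measurable_funX.
have mh k : measurable_fun setT (h k).
  by apply: measurable_funM => //; exact: measurable_funB.
have thdist k w : `|theta k w - ths| <= thmax - thmin.
  have /andP[? ?] := thetab k w; case/andP: Hth => ? ?.
  by rewrite ler_norml; apply/andP; split; lra.
(* The hypothesis on [b], doubled; its finiteness makes the squared penalty integrable. *)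
have Eq2b k : (\int[P]_w (q k w)%:E <= (2 * b)%:E)%E.
  have := Hb k; rewrite unlock.
  rewrite (_ : (fun w => _) = fun w => (q k w)%:E); last first.
    by apply/funext => w /=; rewrite penE.
  by rewrite div1r lee_pdivrMl// EFinM.
have iq k : P.-integrable setT (EFin \o q k).
  apply/integrableP; split; first exact/measurable_EFinP.
  under eq_integral do rewrite gee0_abs ?lee_fin ?sqr_ge0//.
  by rewrite (le_lt_trans (Eq2b k))// ltry.
have iz k : P.-integrable setT (EFin \o z k).
  apply: (@le_integrable _ _ _ _ _ measurableT _ (cst ((thmax - thmin) ^+ 2)%:E)).
  - exact/measurable_EFinP.
  - move=> w _; rewrite /= /z lee_fin !ger0_norm ?sqr_ge0//.
    by rewrite -(real_normK (num_real (theta k w - ths))) lerXn2r// nnegrE ?subr_ge0.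
  - exact: finite_measure_integrable_cst.
(* Boundedness of [theta k w - ths] and [u <= 1 + u^2] dominate the cross term by a multiple of
   [1 + q k]. *)
have ih k : P.-integrable setT (fun w => (h k (theta k w, S k w))%:E).
  have i1q : P.-integrable setT (fun w => ((thmax - thmin)%:E * (1%E + (q k w)%:E))%E).
    apply: integrableZl => //.
    apply: (integrableD measurableT _ (iq k)); exact: finite_measure_integrable_cst.
  apply: le_integrable i1q => //.
    by apply/measurable_EFinP; exact: measurableT_comp (mh k) (mpair k).
  move=> w _; rewrite -EFinD -EFinM !abse_EFin lee_fin [leRHS]ger0_norm; last first.
    by rewrite mulr_ge0 ?subr_ge0// addr_ge0// sqr_ge0.
  rewrite normrM ler_pM// ?thdist// /q /= -(real_normK (num_real (pen k _))).
  move: `|pen k _| => u; have := sqr_ge0 (u - 1); have := sqr_ge0 u; lra.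
have AB a : achievable P S OmegaS D a -> Tmin <= a.1 /\ a.2 <= Rmax.
  move=> [kappa [kD E1 E2]]; rewrite -!lee_fin -E1 -E2.
  by have [/andP[-> _] /andP[_ ->]] := (mb_T Hmom 0 kD, mb_R Hmom 0 kD).
(* With [theta k w] frozen, the inner mean is [theta k w - ths] times the greedy mean penalty, which
   [ratio_gap] bounds for each [w]. *)
have drift k : (\int[P]_w (h k (theta k w, S k w))%:E <=
    (- Tmin)%:E * \int[P]_w (z k w)%:E)%E.
  have [iF ->] := state_Fubini mS (rs_indep Hsys) mF (gr_init Hrun) thetaS
    (rs_ident Hsys) (mh k) (ih k).
  rewrite -(integralZl measurableT (iz k)); apply: le_integral => //;
    first exact: integrableZl.
  move=> w _; have [a0 Aa0 [amax [ia aE]]] := greedy_maximal Hsys (greedy k) (thetab k w).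
  have -> : (\int[P]_w' (h k (theta k w, S 0%N w'))%:E = (theta k w - ths)%:E *
      \int[P]_w' ((g k (theta k w, S 0%N w')).2 -
                  theta k w * (g k (theta k w, S 0%N w')).1)%:E)%E.
    by rewrite -(integralZl measurableT ia); apply: eq_integral => w' _; rewrite -EFinM.
  rewrite aE -!EFinM lee_fin.
  apply: (ratio_gap T0 Aa0 AB amax); exact: erefl.
pose Ez k := fine (\int[P]_w (z k w)%:E).
have EzE k : (\int[P]_w (z k w)%:E = (Ez k)%:E)%E.
  by rewrite fineK//; exact: integrable_fin_num (iz k).
(* The projection is dropped and the square expanded; [h] is the cross term and [q] the quadratic
   one. *)
have zS k w : z k.+1 w <= z k w +
    (2 * eta k * h k (theta k w, S k w) + eta k ^+ 2 * q k w).
  rewrite /z thetaS (le_trans (sqr_clip_le _ Hth))// /h /q /=.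
  by rewrite le_eqVlt; apply/orP; left; apply/eqP; ring.
have EhE k : (\int[P]_w (h k (theta k w, S k w))%:E =
    (fine (\int[P]_w (h k (theta k w, S k w))%:E))%:E)%E.
  by rewrite fineK//; exact: integrable_fin_num (ih k).
have EqE k : (\int[P]_w (q k w)%:E = (fine (\int[P]_w (q k w)%:E))%:E)%E.
  by rewrite fineK//; exact: integrable_fin_num (iq k).
have Erec k : Ez k.+1 <= (1 - 2 / (k + 2)%N%:R) * Ez k
    + 2 * b / Tmin ^+ 2 / (k + 2)%N%:R ^+ 2.
  have i2h := integrableZl measurableT (2 * eta k) (ih k).
  have i2q := integrableZl measurableT (eta k ^+ 2) (iq k).
  have isum := integrableD measurableT i2h i2q.
  have step : (\int[P]_w (z k.+1 w)%:E <= \int[P]_w (z k w)%:E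
      + ((2 * eta k)%:E * \int[P]_w (h k (theta k w, S k w))%:E
         + (eta k ^+ 2)%:E * \int[P]_w (q k w)%:E))%E.
    rewrite -(integralZl measurableT (ih k)) -(integralZl measurableT (iq k)).
    rewrite -(integralD measurableT i2h i2q) -(integralD measurableT (iz k) isum).
    apply: (le_integral measurableT (iz k.+1) (integrableD measurableT (iz k) isum)).
    by move=> w _; rewrite /= -!EFinM -!EFinD lee_fin zS.
  have dk := drift k; have qk := Eq2b k.
  rewrite !EzE EhE EqE -!EFinM -!EFinD lee_fin in step dk qk *.
  move: (fine _) (fine _) step dk qk => Eh Eq step dk qk.
  have n0 : 0 < (k + 2)%N%:R :> R by rewrite ltr0n addn2.
  rewrite (le_trans step)//.
  (* The stepsize makes [2 * eta k * Tmin] equal to [2 / (k + 2)] and [eta k ^+ 2 * (2 * b)] equal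
     to [c / (k + 2)^2], where [c = 2 * b / Tmin ^+ 2]. *)
  have -> : (1 - 2 / (k + 2)%N%:R) * Ez k + 2 * b / Tmin ^+ 2 / (k + 2)%N%:R ^+ 2 =
      Ez k + (2 * eta k * (- Tmin * Ez k) + eta k ^+ 2 * (2 * b)).
    by rewrite /eta; field; rewrite !gt_eqF.
  by rewrite lerD2l lerD// ler_wpM2l// ?sqr_ge0// mulr_ge0.
move=> k k1; rewrite unlock -/(z k) EzE lee_fin.
have -> : 2 * b / (k%:R * Tmin ^+ 2) = 2 * b / Tmin ^+ 2 / k%:R.
  by rewrite invfM mulrA mulrAC.
apply: (recursion_rate _ Erec k1).
(* Nonnegativity of [b] is deduced: [2 * b] bounds the mean of a square. *)
rewrite divr_ge0 ?sqr_ge0// -lee_fin (le_trans _ (Eq2b 0%N))//.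
by apply: integral_ge0 => w _; rewrite lee_fin sqr_ge0.
Qed.
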